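(* Let $(\Omega,d)$ be a complete metric space equipped with an average $A_\omega$, let $S$ be a subdivision scheme on $\Omega$, and let $\mathcal{D}\subset\Omega^{\mathbb{Z}}$ be a set of sequences $P$ with $\delta(P)<\infty$ such that $P\in\mathcal{D}$ implies $S(P)\in\mathcal{D}$. If $S$ is contractive in $\mathcal{D}$ with contractivity factor $\mu\in(0,1)$ and contractivity level $L\in\mathbb{N}$, and $S$ is displacement-safe in $\mathcal{D}$, then $S$ converges to a continuous limit $Q^\infty:\mathbb{R}\to\Omega$ from any initial data $(T^0,P^0)$ with $P^0\in\mathcal{D}$.
   Context: **Average.** An average on $(\Omega,d)$ is a family of maps $A_\omega:\Omega\times\Omega\to\Omega$, $\omega\in[0,1]$, such that for all $x,y\in\Omega$: (i) $\omega\mapsto A_\omega(x,y)$ is continuous on $[0,1]$; (ii) $A_0(x,y)=x$, $A_1(x,y)=y$; (iii) $A_\omega(x,x)=x$; (iv) $A_\omega(x,y)=A_{1-\omega}(y,x)$; (v) $\max\{d(x,A_\omega(x,y)),d(y,A_\omega(x,y))\}\le d(x,y)$. **Subdivision scheme.** A binary refinement operator is a map $S:\Omega^{\mathbb{Z}}\to\Omega^{\mathbb{Z}}$ that is local: there is $M_S\in\mathbb{N}$ such that for all $j\in\mathbb{Z}$, $S(P)_{2j}$ and $S(P)_{2j+1}$ do not depend on $P_\ell$ for $\ell<j-M_S$ or $\ell>j+M_S$. A subdivision scheme is the repeated application $P^k=S(P^{k-1})$, $k\in\mathbb{N}$, where $P^k$ is associated with a parameter sequence $T^k=\{t_j^k\}_{j\in\mathbb{Z}}$,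 which is either the primal one, $t_j^k=j2^{-k}$, or the dual one, $t_j^k=j2^{-k}+\sum_{\ell=2}^{k+1}2^{-\ell}$ (empty sum for $k=0$). **Convergence.** For $Q=\{(t_j,p_j)\}_{j\in\mathbb{Z}}$ the piecewise average interpolant is $\mathcal{PA}(A_\omega,Q;t)=A_{\omega}(p_j,p_{j+1})$ with $\omega=\frac{t-t_j}{t_{j+1}-t_j}$ for $t\in[t_j,t_{j+1}]$. The scheme $S$ converges from $P$ to $Q^\infty:\mathbb{R}\to\Omega$ if the interpolants $f^k(t)=\mathcal{PA}(A_\omega,\{(t_j^k,S^k(P)_j)\}_{j\in\mathbb{Z}};t)$ converge to $Q^\infty$ uniformly on $\mathbb{R}$, i.e. $\sup_{t\in\mathbb{R}}d(f^k(t),Q^\infty(t))\to0$. **Other notions.** $\delta(P)=\sup_{j\in\mathbb{Z}}d(p_j,p_{j+1})$ for $P=\{p_j\}$. $S$ is contractive in $\mathcal{D}$ with contractivity factor $\mu\in(0,1)$ and contractivity level $L\in\mathbb{N}$ if $\delta(S^L(P))\le\mu\,\delta(P)$ for all $P\in\mathcal{D}$. $S$ is displacement-safe in $\mathcal{D}$ if there is a constant $C_S\ge0$, independent of $P$, such that $d(S(P)_{2j},p_j)\le C_S\,\delta(P)$ for all $j\in\mathbb{Z}$, $P\in\mathcal{D}$. *)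

(* Defs.v *)
From HB Require Import structures.
From mathcomp Require Import all_boot all_order all_algebra.
From mathcomp Require Import all_classical all_reals all_analysis.

Set Implicit Arguments.
Unset Strict Implicit.
Unset Printing Implicit Defensive.

Import Order.TTheory GRing.Theory Num.Theory.
Import numFieldNormedType.Exports.

Local Open Scope classical_set_scope.
Local Open Scope ring_scope.

(* The library's completeType is pointed, so this structure excludes only the
   empty metric space, over which there are no sequences indexed by int. *)
#[short(type="completeMetricType")]
HB.structure Definition CompleteMetric (K : numDomainType) :=
  {T of Metric K T & Complete T}.

Section subdivision.
Context {R : realType} {Omega : metricType R}.
Implicit Types (A : R -> Omega -> Omega -> Omega) (P : int -> Omega)
  (S : (int -> Omega) -> (int -> Omega)) (D : set (int -> Omega)).

(* Only the values A w with 0 <= w <= 1 are meaningful. *)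
Record is_average A : Prop := IsAverage {
  average_continuous : forall x y, {within `[0, 1], continuous (fun w => A w x y)} ;
  average0 : forall x y, A 0 x y = x ;
  average1 : forall x y, A 1 x y = y ;
  average_diag : forall w x, 0 <= w <= 1 -> A w x x = x ;
  average_sym : forall w x y, 0 <= w <= 1 -> A w x y = A (1 - w) y x ;
  average_bound : forall w x y, 0 <= w <= 1 ->
    Num.max (mdist x (A w x y)) (mdist y (A w x y)) <= mdist x y
}.

Definition is_local S : Prop :=
  exists2 M : nat, (0 < M)%N & forall (j : int) P P',
    (forall l : int, j - M%:Z <= l <= j + M%:Z -> P l = P' l) ->
    S P (2 * j) = S P' (2 * j) /\ S P (2 * j + 1) = S P' (2 * j + 1).

Inductive parametrization := Primal | Dual.

Definition param (c : parametrization) (k : nat) (j : int) : R :=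
  match c with
  | Primal => j%:~R * 2 ^- k
  | Dual => j%:~R * 2 ^- k + \sum_(2 <= l < k.+2) 2 ^- l
  end.

(* The interval [T j, T (j + 1)[ containing t is selected by choice; see PAE for
   the value on the closed intervals. *)
Definition PA A (T : int -> R) P (t : R) : Omega :=
  let j := xget 0 [set j : int | T j <= t < T (j + 1)] in
  A ((t - T j) / (T (j + 1) - T j)) (P j) (P (j + 1)).

Lemma PAE A (T : int -> R) P (j : int) (t : R) : is_average A ->
    {homo T : i k / i < k} -> T j <= t <= T (j + 1) ->
  PA A T P t = A ((t - T j) / (T (j + 1) - T j)) (P j) (P (j + 1)).
Proof.
move=> hA Tmono /andP[Tt tT].
have Tle i k : i <= k -> T i <= T k.
  by rewrite le_eqVlt => /predU1P[->//|/Tmono/ltW].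
have uniqj i k : T i <= t < T (i + 1) -> T k <= t < T (k + 1) -> i = k.
  move=> /andP[h1 h2] /andP[h3 h4]; apply/eqP; rewrite eq_le; apply/andP; split.
    rewrite leNgt; apply/negP; rewrite -lezD1 => /Tle h.
    by have := lt_le_trans h4 (le_trans h h1); rewrite ltxx.
  rewrite leNgt; apply/negP; rewrite -lezD1 => /Tle h.
  by have := lt_le_trans h2 (le_trans h h3); rewrite ltxx.
have Tj1 i : T i < T (i + 1) by apply: Tmono; rewrite ltrDl.
have xgetE i : T i <= t < T (i + 1) ->
    xget 0 [set j : int | T j <= t < T (j + 1)] = i.
  by move=> hi; case: xgetP => [k _ /uniqj/(_ hi)//|/(_ i)/(_ hi)].
move: tT; rewrite le_eqVlt => /predU1P[tE|tT]; last first.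
  by rewrite /PA (@xgetE j) ?Tt.
rewrite /PA (@xgetE (j + 1)) ?tE ?lexx ?Tj1//.
rewrite subrr mul0r (average0 hA) divff ?(average1 hA)//.
by rewrite subr_eq0 gt_eqF.
Qed.

Lemma param_homo c k : {homo param c k : i j / i < j}.
Proof.
move=> i j ij; have h : i%:~R * 2 ^- k < j%:~R * 2 ^- k :> R.
  by rewrite ltr_pM2r ?ltr_int// invr_gt0 exprn_gt0.
by case: c => //=; rewrite ltrD2r.
Qed.

Definition delta P : \bar R :=
  ereal_sup (range (fun j : int => (mdist (P j) (P (j + 1)))%:E)).

Definition contractive S D (mu : R) (L : nat) : Prop :=
  [/\ 0 < mu < 1, (0 < L)%N &
    forall P, D P -> (delta (iter L S P) <= mu%:E * delta P)%E].

Definition displacement_safe S D : Prop :=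
  exists2 C : R, 0 <= C & forall P, D P -> forall j : int,
    ((mdist (S P (2 * j)) (P j))%:E <= C%:E * delta P)%E.

Definition scheme_converges A c S P (Q : R -> Omega) : Prop :=
  ereal_sup (range (fun t : R => (mdist (PA A (param c k) (iter k S P) t) (Q t))%:E))
    @[k --> \oo] --> 0%E.

End subdivision.

(* Main.v *)
Require Import Defs.
From HB Require Import structures.
From mathcomp Require Import all_boot all_order all_algebra.
From mathcomp Require Import all_classical all_reals all_analysis.
From mathcomp Require Import lra.

(** Write P^k for the k-th refinement of the initial data and f^k for its
    piecewise average interpolant.  Contractivity every L levels makes
    delta(P^k) decay geometrically: along each residue class modulo L it is
    multiplied by at most mu at every step, and the L starting values are
    finite because the iterates stay in D.  So delta(P^k) <= K rho^k with
    rho = mu^(1/L) ([stepwise_geometric_bound]).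

    Everything else is measured against delta(P^k).  A point f^k(t) lies within
    delta(P^k) of the vertex p_j^k whose cell contains t, by the metric bound on
    averages ([PA_near_vertex]).  The cells of level k and k+1 that contain t
    have indices j and i with |i - 2j| <= 1, for both parametrizations
    ([param_interlaced]), and displacement safety compares p_j^k with
    p_{2j}^{k+1}.  Hence f^k and f^{k+1} are at uniform distance at most a
    constant times rho^k ([PA_refine]), the f^k(t) are Cauchy, and their limits
    Q(t) satisfy d(f^k(t), Q(t)) <= E rho^k uniformly in t
    ([geometric_cauchy_limit]).

    For the continuity of Q it is enough that f^k be almost continuous: two
    parameters closer than 2^-k lie in equal or adjacent cells, so their values
    under f^k differ by at most 3 delta(P^k) ([PA_modulus]).  This error also
    tends to 0 with k, so the usual three-term estimate goes through
    ([continuous_geometric_limit]). *)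

Set Implicit Arguments.
Unset Strict Implicit.
Unset Printing Implicit Defensive.

Import Order.TTheory GRing.Theory Num.Theory.
Import numFieldNormedType.Exports.

Local Open Scope classical_set_scope.
Local Open Scope ring_scope.

(** * Geometric decay *)

(** A sequence that shrinks by mu every L steps is dominated by a geometric
    one of ratio rho, the L-th root of mu.  The constant K only has to absorb
    the first L terms, which the hypothesis leaves arbitrary. *)
Lemma stepwise_geometric_bound (R : realType) (u : nat -> R) (mu : R) (L : nat) :
  0 < mu < 1 -> (0 < L)%N -> (forall k, 0 <= u k) ->
  (forall k, u (L + k)%N <= mu * u k) ->
  exists K rho : R, [/\ 0 <= K, 0 < rho < 1 & forall k, u k <= K * rho ^+ k].
Proof.
move=> /andP[mu0 mu1] L0 u0 uL.
pose rho := mu `^ (L%:R^-1).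
have rhoL : rho ^+ L = mu.
  rewrite -powR_mulrn ?powR_ge0// -powRrM mulVf ?powRr1 ?(ltW mu0)//.
  by rewrite pnatr_eq0 -lt0n.
have rho0 : 0 < rho by rewrite powR_gt0.
have rho1 : rho < 1.
  rewrite ltNge; apply/negP => /(exprn_ege1 L).
  by rewrite rhoL leNgt mu1.
pose K := \sum_(i < L) u i / rho ^+ i.
exists K, rho; split=> [||k]; last 1 first.
- have [n] := ubnP k; elim: n k => // n IHn k; rewrite ltnS => kn.
  have [kL|Lk] := ltnP k L.
    rewrite -ler_pdivrMr ?exprn_gt0// /K (bigD1 (Ordinal kL))//= lerDl.
    by apply: sumr_ge0 => i _; rewrite divr_ge0// exprn_ge0// ltW.
  rewrite -(subnKC Lk); apply: (le_trans (uL _)).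
  rewrite exprD rhoL mulrCA ler_wpM2l ?(ltW mu0)//; apply: IHn.
  by rewrite (leq_trans _ kn)// ltn_subrL L0 (leq_trans L0).
- by apply: sumr_ge0 => i _; rewrite divr_ge0// exprn_ge0// ltW.
- by rewrite rho0.
Qed.

Lemma geometric_eventually_small (R : realType) (B rho e : R) :
  0 <= rho < 1 -> 0 < e -> \forall k \near \oo, B * rho ^+ k < e.
Proof.
move=> /andP[rho0 rho1] e0.
have /cvgrPdist_lt/(_ _ e0) : B * rho ^+ k @[k --> \oo] --> 0.
  by apply: cvg_geometric; rewrite ger0_norm.
apply: filterS => k; rewrite sub0r normrN; exact/le_lt_trans/ler_norm.
Qed.

(** The explicit rate, depending on the sequence only through B and rho, turns
    pointwise convergence of the interpolants into uniform convergence. *)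
Lemma geometric_cauchy_limit (R : realType) (T : completeMetricType R)
    (x : nat -> T) (B rho : R) :
  0 <= rho < 1 -> (forall k, mdist (x k) (x k.+1) <= B * rho ^+ k) ->
  exists l, forall k, mdist (x k) l <= B / (1 - rho) * rho ^+ k.
Proof.
move=> rho01 xS; have /andP[rho0 rho1] := rho01.
have c0 : 0 < 1 - rho by rewrite subr_gt0.
set B' := B / (1 - rho).
have BE : B = B' * (1 - rho) by rewrite /B' divfK// gt_eqF.
have B0 : 0 <= B.
  by have := le_trans (mdist_ge0 _ _) (xS 0%N); rewrite expr0 mulr1.
have B'0 : 0 <= B' by rewrite divr_ge0// ltW.
(* The telescoped form of the geometric sum: it survives the induction on n. *)
have tail k n : mdist (x k) (x (k + n)%N) <= B' * (rho ^+ k - rho ^+ (k + n)).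
  elim: n => [|n IHn]; first by rewrite addn0 mdistxx subrr mulr0.
  apply: (le_trans (metric_triangle _ (x (k + n)%N) _)).
  rewrite addnS; apply: (le_trans (lerD IHn (xS _))).
  by rewrite BE exprS; nra.
have tail' k n : mdist (x k) (x (k + n)%N) <= B' * rho ^+ k.
  apply: (le_trans (tail k n)); rewrite ler_wpM2l// gerBl exprn_ge0//.
have /cauchy_cvgP/cvg_ex[l xl] : cauchy (x k @[k --> \oo]).
  apply/cauchyP => e e0.
  have [N _ /(_ N (leqnn N)) BN] := geometric_eventually_small B' rho01 e0.
  exists (x N), N => // n /= Nn; rewrite ballEmdist /=.
  by rewrite -(subnKC Nn); apply: le_lt_trans BN.
exists l => k; apply/ler_addgt0Pr => e e0.
have /metricType_numDomainType.cvgrPdist_le/(_ _ e0)[N _ xN] := xl.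
apply: (le_trans (metric_triangle _ (x (k + N)%N) _)).
by rewrite lerD// metric_sym; apply: xN => /=; apply: leq_addl.
Qed.

(** * Parameter sequences *)

Section parameters.
Context {R : realType}.
Implicit Types (c : parametrization) (k : nat) (j : int) (t : R).

Lemma param_shift c k j : param c k j = param c k 0 + j%:~R * 2 ^- k :> R.
Proof. by case: c => /=; rewrite mul0r add0r// addrC. Qed.

Lemma param_next c k j : param c k (j + 1) = param c k j + 2 ^- k :> R.
Proof. by rewrite param_shift [in RHS]param_shift intrD mulrDl mul1r addrA. Qed.

Lemma param_cell c k t : exists j, param c k j <= t < param c k (j + 1).
Proof.
exists (Num.floor ((t - param c k 0) * 2 ^+ k)).
have /andP[h1 h2] := floor_itv ((t - param c k 0) * 2 ^+ k).
rewrite param_shift [X in _ < X]param_shift -lerBrDl -ltrBlDl.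
by rewrite ler_pdivrMr ?exprn_gt0// ltr_pdivlMr ?exprn_gt0// h1.
Qed.

Lemma param_lt_inv c k i j : param c k i < param c k j :> R -> i < j.
Proof. by rewrite (leW_mono (le_mono (@param_homo R c k))). Qed.

(** Passing from level k to k+1, vertex j becomes vertex 2j, and its parameter
    moves to the right by 0 (primal) or 2^-(k+2) (dual).  Either way this is
    less than one step 2^-(k+1) of the finer grid, which bounds the index of the
    fine cell containing a point in terms of the index of its coarse cell. *)
Lemma param_interlaced c k j :
  param c k.+1 (2 * j - 1) <= (param c k j : R) <= param c k.+1 (2 * j).
Proof.
(* All terms are expressed through the fine step 2^-(k+1), so that the claim
   becomes linear in it. *)
have h0 : 0 < 2 ^- k.+1 :> R by rewrite invr_gt0 exprn_gt0.
have hE : 2 ^- k = 2 * 2 ^- k.+1 :> R.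
  by rewrite exprS invfM mulrA divff ?mul1r// pnatr_eq0.
have hS : 2 ^- k.+2 = 2^-1 * 2 ^- k.+1 :> R by rewrite [in LHS]exprS invfM.
case: c => /=; rewrite hE intrB intrM.
  by apply/andP; split; nra.
by rewrite !(big_nat_recr k.+2)//= hS; apply/andP; split; nra.
Qed.

End parameters.

(** * Interpolants versus vertices *)

Section approximation.
Context {R : realType} {Omega : metricType R}.
Implicit Types (A : R -> Omega -> Omega -> Omega) (P : int -> Omega).

Lemma delta_ge0 P : (0 <= delta P)%E.
Proof.
apply: (@le_trans _ _ (mdist (P 0) (P (0 + 1)))%:E).
  by rewrite lee_fin mdist_ge0.
by apply: ereal_sup_ubound; exists 0.
Qed.

Lemma delta_fineK P : (delta P < +oo)%E -> (fine (delta P))%:E = delta P.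
Proof. by move=> Pfin; rewrite fineK// ge0_fin_numE// delta_ge0. Qed.

Lemma mdist_delta P j : (delta P < +oo)%E ->
  mdist (P j) (P (j + 1)) <= fine (delta P).
Proof.
move=> Pfin; rewrite -lee_fin delta_fineK//.
by apply: ereal_sup_ubound; exists j.
Qed.

Lemma mdist_neighbour P (i j : int) : (delta P < +oo)%E ->
  j - 1 <= i <= j + 1 -> mdist (P i) (P j) <= fine (delta P).
Proof.
move=> Pfin; have d0 : 0 <= fine (delta P) by rewrite fine_ge0// delta_ge0.
have d1 m := mdist_delta m Pfin.
rewrite le_eqVlt => /andP[/predU1P[<- _|]].
  by have := d1 (j - 1); rewrite subrK.
rewrite ltrBlDr ltzD1 => ji; rewrite le_eqVlt => /predU1P[->|].
  by rewrite metric_sym.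
by rewrite ltzD1 => ij; rewrite (le_anti (introT andP (conj ij ji))) mdistxx.
Qed.

Lemma PA_near_vertex A P c k t : is_average A -> (delta P < +oo)%E ->
  exists j, param c k j <= t < param c k (j + 1) /\
    mdist (P j) (PA A (param c k) P t) <= fine (delta P).
Proof.
move=> hA Pfin; have [j jt] := param_cell c k t; exists j; split => //.
have /andP[jt1 jt2] := jt.
have Tj : 0 < param c k (j + 1) - param c k j :> R.
  by rewrite subr_gt0 (le_lt_trans jt1).
rewrite (PAE P hA (@param_homo R c k) (j := j)) ?jt1 ?(ltW jt2)//.
apply: le_trans (mdist_delta j Pfin).
set w := (X in A X).
have w01 : 0 <= w <= 1.
  rewrite /w divr_ge0 ?subr_ge0 ?(ltW Tj)//= ?(le_trans jt1 (ltW jt2))//.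
  by rewrite ler_pdivrMr// mul1r lerD2r ltW.
by apply: le_trans (average_bound hA (P j) (P (j + 1)) w01); rewrite le_max lexx.
Qed.

(** A modulus of near-continuity at the scale of the grid: s and t are in equal
    or adjacent cells, so the path through the two vertices has three legs of
    length at most delta(P). *)
Lemma PA_modulus A P c k s t : is_average A -> (delta P < +oo)%E ->
  `|s - t| < 2 ^- k ->
  mdist (PA A (param c k) P s) (PA A (param c k) P t) <= 3 * fine (delta P).
Proof.
move=> hA Pfin; rewrite ltr_norml => /andP[st1 st2].
have [i [/andP[is1 is2] di]] := PA_near_vertex c k s hA Pfin.
have [j [/andP[jt1 jt2] dj]] := PA_near_vertex c k t hA Pfin.
have ij : j - 1 <= i <= j + 1.
  apply/andP; split.
    rewrite lerBlDr -ltzD1; apply: (@param_lt_inv R c k).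
    by rewrite param_next; lra.
  rewrite -ltzD1; apply: (@param_lt_inv R c k).
  by rewrite param_next; lra.
have dij := mdist_neighbour Pfin ij.
rewrite metric_sym in di.
have := metric_triangle (PA A (param c k) P s) (P i) (PA A (param c k) P t).
have := metric_triangle (P i) (P j) (PA A (param c k) P t).
lra.
Qed.

(** Path from f^k(t) to f^{k+1}(t): to the coarse vertex p_j, to its refinement
    p'_{2j}, to the neighbouring fine vertex p'_i, to f^{k+1}(t). *)
Lemma PA_refine A P P' c k (C : R) t : is_average A ->
  (delta P < +oo)%E -> (delta P' < +oo)%E ->
  (forall j, mdist (P' (2 * j)) (P j) <= C) ->
  mdist (PA A (param c k) P t) (PA A (param c k.+1) P' t)
    <= fine (delta P) + C + 2 * fine (delta P').
Proof.
move=> hA Pfin P'fin PC.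
have [j [/andP[jt1 jt2] dj]] := PA_near_vertex c k t hA Pfin.
have [i [/andP[it1 it2] di]] := PA_near_vertex c k.+1 t hA P'fin.
have /andP[j1 _] := @param_interlaced R c k j.
have /andP[_ j2] := @param_interlaced R c k (j + 1).
have ij : 2 * j - 1 <= i <= 2 * j + 1.
  apply/andP; split; rewrite -ltzD1; apply: (@param_lt_inv R c k.+1).
    by apply: le_lt_trans it2; apply: le_trans jt1.
  apply: (le_lt_trans it1); apply: (lt_le_trans jt2).
  by rewrite -addrA -[1 + 1]/(2 * 1 : int) -mulrDr.
have dij := mdist_neighbour P'fin ij.
have dC := PC j; rewrite metric_sym in dC; rewrite metric_sym in dij.
set f := PA A (param c k) P t in dj *.
set f' := PA A (param c k.+1) P' t in di *.
have t1 := metric_triangle f (P j) f'.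
have t2 := metric_triangle (P j) (P' (2 * j)) f'.
have t3 := metric_triangle (P' (2 * j)) (P' i) f'.
rewrite (metric_sym f (P j)) in t1.
lra.
Qed.

End approximation.

(** * Uniform limits *)

(** The oscillation K rho^k of f^k at scale 2^-k vanishes in the limit together
    with the approximation error E rho^k, so for k large the distance of Q(s)
    and Q(t) through f^k(s) and f^k(t) is as small as desired. *)
Lemma continuous_geometric_limit (R : realType) (Omega : metricType R)
    (f : nat -> R -> Omega) (Q : R -> Omega) (E K rho : R) :
  0 <= rho < 1 ->
  (forall k t, mdist (f k t) (Q t) <= E * rho ^+ k) ->
  (forall k s t, `|s - t| < 2 ^- k -> mdist (f k s) (f k t) <= K * rho ^+ k) ->
  continuous Q.
Proof.
move=> rho01 fQ ff t; apply/metricType_numDomainType.cvgrPdist_le => e e0.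
have [k _ /(_ k (leqnn k)) ke] :=
  geometric_eventually_small (2 * E + K) rho01 e0.
have : \forall s \near t, `|t - s| < 2 ^- k.
  by apply/nbhs_ballP; exists (2 ^- k) => //=; rewrite invr_gt0 exprn_gt0.
apply: filterS => s /ff ts.
have t1 := metric_triangle (Q t) (f k t) (Q s).
have t2 := metric_triangle (f k t) (f k s) (Q s).
have Qt := fQ k t; have Qs := fQ k s; rewrite metric_sym in Qt.
apply: le_trans (ltW ke); rewrite mulrDl -mulrA; lra.
Qed.

Lemma ereal_sup_geometric_cvg (R : realType) (g : nat -> R -> R) (E rho : R) :
  0 <= rho < 1 -> (forall k t, 0 <= g k t <= E * rho ^+ k) ->
  ereal_sup (range (fun t => (g k t)%:E)) @[k --> \oo] --> 0%E.
Proof.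
move=> /andP[rho0 rho1] gE.
apply: (@squeeze_cvge _ _ _ _ (cst 0%E) _ (fun k => (E * rho ^+ k)%:E)).
- apply: nearW => k; apply/andP; split.
    apply: (@le_trans _ _ (g k 0)%:E).
      by rewrite lee_fin; have /andP[] := gE k 0.
    by apply: ereal_sup_ubound; exists 0.
  by apply: ge_ereal_sup => _ [t _ <-]; rewrite lee_fin; have /andP[] := gE k t.
- exact: cvg_cst.
- apply: cvg_EFin; first exact: nearW.
  by apply: cvg_geometric; rewrite ger0_norm.
Qed.

Theorem theorem4p9 (R : realType) (Omega : completeMetricType R)
    (A : R -> Omega -> Omega -> Omega) (hA : is_average A)
    (S : (int -> Omega) -> (int -> Omega)) (hS : is_local S)
    (c : parametrization)
    (D : set (int -> Omega))
    (D_fin : forall P, D P -> (delta P < +oo)%E)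
    (D_stable : forall P, D P -> D (S P))
    (mu : R) (L : nat) (S_contractive : contractive S D mu L)
    (S_safe : displacement_safe S D)
    (P0 : int -> Omega) (DP0 : D P0) :
  exists Q : R -> Omega, continuous Q /\ scheme_converges A c S P0 Q.
Proof.
have DP k : D (iter k S P0) by elim: k => //= k; exact: D_stable.
have Pfin k := D_fin _ (DP k).
have [mu01 L0 muL] := S_contractive.
have [C C0 SC] := S_safe.
pose u k := fine (delta (iter k S P0)).
have u0 k : 0 <= u k by rewrite fine_ge0// delta_ge0.
(* Contractivity is used at every iterate, not just at multiples of L: nothing
   bounds delta (S P) by delta P when L > 1. *)
have uL k : u (L + k)%N <= mu * u k.
  rewrite -lee_fin EFinM !delta_fineK// iterD; exact: muL.
have [K [rho [K0 /andP[rho0 rho1] uK]]] := stepwise_geometric_bound mu01 L0 u0 uL.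
have rho01 : 0 <= rho < 1 by rewrite ltW.
pose f k := PA A (param c k) (iter k S P0).
have fS t k : mdist (f k t) (f k.+1 t) <= (3 + C) * K * rho ^+ k.
  have SCk j : mdist (iter k.+1 S P0 (2 * j)) (iter k S P0 j) <= C * u k.
    rewrite -lee_fin EFinM delta_fineK//; exact: (SC _ (DP k) j).
  apply: (le_trans (PA_refine c k t hA (Pfin k) (Pfin k.+1) SCk)).
  have uSk : u k.+1 <= K * rho ^+ k.
    apply: (le_trans (uK _)); rewrite ler_wpM2l// exprS ger_pMl ?exprn_gt0//.
    exact: ltW.
  have Cuk := ler_wpM2l C0 (uK k).
  have uk := uK k; rewrite -/(u k) -/(u k.+1) -mulrA mulrDl; lra.
have /choice[Q fQ] t : exists l, forall k,
    mdist (f k t) l <= (3 + C) * K / (1 - rho) * rho ^+ k.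
  exact: geometric_cauchy_limit rho01 (fS t).
exists Q; split.
  apply: (@continuous_geometric_limit R Omega f Q _ (3 * K) rho rho01).
    by move=> k t; exact: fQ.
  move=> k s t st; apply: (le_trans (PA_modulus c hA (Pfin k) st)).
  by rewrite -mulrA ler_wpM2l// uK.
apply: ereal_sup_geometric_cvg rho01 _ => k t.
by rewrite mdist_ge0; exact: fQ.
Qed.
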